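(* Let $I\subseteq\mathbb{R}$ be an open interval, let $B,C\in\mathbb{C}$ be constants and let $R:I\to\mathbb{C}$ be a function. Let $\sqrt{B^2-4C}$ denote a square root of $B^2-4C$ in $\mathbb{C}$, and put $$g(x)=e^{\left(\frac{B}{2}\pm\frac{\sqrt{B^2-4C}}{2}\right)x},\qquad h(x)=e^{\left(\frac{B}{2}\mp\frac{\sqrt{B^2-4C}}{2}\right)x},$$ where either the upper signs are taken in both formulas or the lower signs are taken in both. Assume that the indefinite integral $\int g(x)R(x)\,dx$ exists on $I$. Then the general solution on $I$ of $$y''+By'+Cy=R(x)$$ is $$y=\frac{1}{h(x)}\int\frac{h(x)}{g(x)}\left(\int g(x)R(x)\,dx\right)dx+\frac{C_1}{h(x)}\int\frac{h(x)}{g(x)}\,dx+\frac{C_2}{h(x)},$$ where $C_1,C_2\in\mathbb{C}$ are arbitrary constants; that is, a twice differentiable function $y:I\to\mathbb{C}$ satisfies the differential equation on $I$ if and only if it has this form for some $C_1,C_2\in\mathbb{C}$.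
   Context: An indefinite integral $\int u(x)\,dx$ of a function $u$ on $I$ denotes one fixed (arbitrarily chosen) antiderivative of $u$ on $I$, i.e. a differentiable function $U$ with $U'=u$ on $I$; each time the same integral occurs the same antiderivative is used. The arbitrary constants of integration are displayed explicitly as $C_1,C_2$. *)

(* Defs.v *)
From Stdlib Require Import Reals.
From Coquelicot Require Import Coquelicot.

Open Scope C_scope.

(** A function on the open interval [(a, b)]
    (with endpoints possibly infinite) is represented by a total function
    [R -> C] of which only the values on the interval matter. *)

Definition open_itv (a b : Rbar) (x : R) : Prop := Rbar_lt a x /\ Rbar_lt x b.

(** Neither Stdlib nor Coquelicot has the exponential on [C]:
    [exp (u + i v) = exp u * (cos v + i sin v)]. *)
Definition Cexp (z : C) : C :=
  ((exp (Re z) * cos (Im z))%R, (exp (Re z) * sin (Im z))%R).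

(** The scalars are fixed to the reals: [C] is also a normed module over itself,
    for which [is_derive] would mean complex differentiability. *)
Definition is_deriv (F : R -> C) (x : R) (l : C) : Prop :=
  @is_derive R_AbsRing C_R_NormedModule F x l.

Definition antiderivative_on (I : R -> Prop) (u U : R -> C) : Prop :=
  forall x : R, I x -> is_deriv U x (u x).

(** [y1] and [y2] are the first and second derivatives of [y] on [I]. Their
    values outside [I] are irrelevant since [I] is meant to be open. *)
Definition is_solution (I : R -> Prop) (B C0 : C) (f y : R -> C) : Prop :=
  exists y1 y2 : R -> C,
    (forall x : R, I x -> is_deriv y x (y1 x)) /\
    (forall x : R, I x -> is_deriv y1 x (y2 x)) /\
    (forall x : R, I x -> y2 x + B * y1 x + C0 * y x = f x).

(** [s] is the chosen square root of [B^2 - 4 C0]; [sgn = 1] selects the upper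
    signs and [sgn = -1] the lower signs, simultaneously in [gfun] and [hfun]. *)
Definition gfun (B s sgn : C) (x : R) : C :=
  Cexp ((B / 2 + sgn * (s / 2)) * x).

Definition hfun (B s sgn : C) (x : R) : C :=
  Cexp ((B / 2 - sgn * (s / 2)) * x).

(* Main.v *)
(** With [p = B/2 + sgn s/2] and [q = B/2 - sgn s/2] we have [p + q = B] and
    [p q = C0], so the equation factors as [(D + p) (D + q) y = f]. Since
    [g = exp (p x)] and [h = exp (q x)], it says that [g (y' + q y)] is an
    antiderivative of [g f], and [(h y)' = (h / g) (g (y' + q y))]; integrating
    twice gives the formula. *)

Require Import Defs.
From Stdlib Require Import Reals Lra Classical.
From Coquelicot Require Import Coquelicot.
Open Scope C_scope.

(** * Differentiation of complex-valued functions of a real variable *)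

Lemma is_deriv_components (F : R -> C) (x : R) (l : C) :
  is_deriv F x l <->
  is_derive (fun t => Re (F t)) x (Re l) /\ is_derive (fun t => Im (F t)) x (Im l).
Proof.
  split.
  - intro H; split.
    + exact (filterdiff_comp' F fst x _ _ H
               (filterdiff_linear _ (@is_linear_fst R_AbsRing R_NormedModule R_NormedModule))).
    + exact (filterdiff_comp' F snd x _ _ H
               (filterdiff_linear _ (@is_linear_snd R_AbsRing R_NormedModule R_NormedModule))).
  - intros [Hre Him].
    (* [F] is rebuilt as [Re F] times the constant vector 1 plus [Im F] times the constant vector
       [Ci], so only real coefficients are differentiated. *)
    pose proof (@is_derive_plus R_AbsRing C_R_NormedModule _ _ _ _ _
      (@is_derive_scal_l R_AbsRing C_R_NormedModule _ _ _ (RtoC 1) Hre)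
      (@is_derive_scal_l R_AbsRing C_R_NormedModule _ _ _ Ci Him)) as H.
    assert (E : forall z : C,
      @plus C_R_NormedModule (@scal R_AbsRing C_R_NormedModule (Re z) (RtoC 1))
        (@scal R_AbsRing C_R_NormedModule (Im z) Ci) = z).
    { intros [u v]; apply injective_projections; cbn; unfold mult; cbn; ring. }
    rewrite E in H.
    apply (is_derive_ext (V := C_R_NormedModule)) with (2 := H).
    intro t; apply E.
Qed.

Lemma is_deriv_val (F : R -> C) (x : R) (l l' : C) :
  is_deriv F x l -> l = l' -> is_deriv F x l'.
Proof. now intros H <-. Qed.

Lemma is_deriv_const (c : C) (x : R) : is_deriv (fun _ => c) x 0.
Proof. exact (@is_derive_const R_AbsRing C_R_NormedModule c x). Qed.

Lemma is_deriv_plus (F G : R -> C) (x : R) (l m : C) :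
  is_deriv F x l -> is_deriv G x m -> is_deriv (fun t => F t + G t) x (l + m).
Proof. exact (@is_derive_plus R_AbsRing C_R_NormedModule F G x l m). Qed.

Lemma is_deriv_minus (F G : R -> C) (x : R) (l m : C) :
  is_deriv F x l -> is_deriv G x m -> is_deriv (fun t => F t - G t) x (l - m).
Proof. exact (@is_derive_minus R_AbsRing C_R_NormedModule F G x l m). Qed.

(** Each component of a complex product is a sum or difference of two real products, so the real
    product rule applies to every term. *)
Lemma is_deriv_mult (F G : R -> C) (x : R) (l m : C) :
  is_deriv F x l -> is_deriv G x m ->
  is_deriv (fun t => F t * G t) x (l * G x + F x * m).
Proof.
  rewrite !is_deriv_components; intros [Fr Fi] [Gr Gi]; split.
  - replace (Re (l * G x + F x * m))
      with ((Re l * Re (G x) + Re (F x) * Re m)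
            - (Im l * Im (G x) + Im (F x) * Im m))%R by (unfold Re, Im; cbn; ring).
    apply (is_derive_minus (V := R_NormedModule));
      now apply Derive.is_derive_mult.
  - replace (Im (l * G x + F x * m))
      with ((Re l * Im (G x) + Re (F x) * Im m)
            + (Im l * Re (G x) + Im (F x) * Re m))%R by (unfold Re, Im; cbn; ring).
    apply (is_derive_plus (V := R_NormedModule));
      now apply Derive.is_derive_mult.
Qed.

Lemma is_deriv_scal (c : C) (F : R -> C) (x : R) (l : C) :
  is_deriv F x l -> is_deriv (fun t => c * F t) x (c * l).
Proof.
  intro H; eapply is_deriv_val.
  - exact (is_deriv_mult _ _ _ _ _ (is_deriv_const c x) H).
  - cbv beta; ring.
Qed.

Lemma is_deriv_continuous (F : R -> C) (x : R) (l : C) :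
  is_deriv F x l -> @continuous R_UniformSpace C_R_NormedModule F x.
Proof.
  intro H; apply (@ex_derive_continuous R_AbsRing C_R_NormedModule).
  now exists l.
Qed.

(** * The complex exponential *)

Lemma Cexp_plus (u v : C) : Cexp (u + v) = Cexp u * Cexp v.
Proof.
  destruct u as [a b], v as [c d]; unfold Cexp; cbn.
  rewrite exp_plus, cos_plus, sin_plus.
  apply injective_projections; cbn; ring.
Qed.

Lemma Cexp_0 : Cexp 0 = 1.
Proof.
  unfold Cexp; cbn; rewrite exp_0, cos_0, sin_0.
  apply injective_projections; cbn; ring.
Qed.

Lemma Cexp_neq_0 (z : C) : Cexp z <> 0.
Proof.
  intro H; apply C1_nz; rewrite <- Cexp_0.
  (* Only the exponent is rewritten: a zero of [Cexp] at [z] would force [Cexp 0], which is 1, to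
     vanish. *)
  replace (RtoC 0) with (z + - z) at 1 by ring.
  rewrite Cexp_plus, H; ring.
Qed.

Lemma Cexp_minus (u v : C) : Cexp (u - v) = Cexp u / Cexp v.
Proof.
  replace u with ((u - v) + v) at 2 by ring.
  rewrite Cexp_plus; field; apply Cexp_neq_0.
Qed.

Lemma is_deriv_Cexp_linear (c : C) (x : R) :
  is_deriv (fun t => Cexp (c * t)) x (c * Cexp (c * x)).
Proof.
  destruct c as [a b]; apply is_deriv_components; split; unfold Cexp, Re, Im; cbn;
    auto_derive; trivial; unfold Rminus; ring.
Qed.

(** * Antiderivatives on an open interval *)

Lemma open_itv_between (a b : Rbar) (x y z : R) :
  open_itv a b x -> open_itv a b y -> (Rmin x y <= z <= Rmax x y)%R ->
  open_itv a b z.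
Proof.
  unfold open_itv, Rmin, Rmax; destruct (Rle_dec x y);
    destruct a, b; cbn; intuition lra.
Qed.

Lemma locally_open_itv (a b : Rbar) (x : R) :
  open_itv a b x -> locally x (open_itv a b).
Proof.
  intros [Ha Hb]; apply filter_and.
  - now apply open_Rbar_gt.
  - now apply open_Rbar_lt.
Qed.

(** The interval is a neighbourhood of each of its points. This lets a solution be differentiated
    through a formula known only on the interval. *)
Lemma is_deriv_ext_itv (a b : Rbar) (F G : R -> C) (x : R) (l : C) :
  (forall t, open_itv a b t -> F t = G t) -> open_itv a b x ->
  is_deriv F x l -> is_deriv G x l.
Proof.
  intros E Hx; apply (is_derive_ext_loc (V := C_R_NormedModule)).
  now apply (filter_imp (open_itv a b)), locally_open_itv.
Qed.

Lemma antiderivative_of_0 (a b : Rbar) (F : R -> C) :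
  antiderivative_on (open_itv a b) (fun _ => 0) F ->
  exists c, forall x, open_itv a b x -> F x = c.
Proof.
  intro H.
  destruct (classic (exists x0, open_itv a b x0)) as [[x0 H0] | He].
  - assert (L : forall x y, open_itv a b x -> open_itv a b y -> (x < y)%R -> F x = F y).
    { intros x y Hx Hy Hxy.
      apply (@eq_is_derive C_R_NormedModule F x y); trivial.
      intros t Ht; apply H, (open_itv_between _ _ x y); trivial.
      now rewrite Rmin_left, Rmax_right by lra. }
    exists (F x0); intros x Hx.
    destruct (Rtotal_order x x0) as [Hlt | [-> | Hgt]].
    + now apply L.
    + reflexivity.
    + symmetry; now apply L.
  (* On an empty interval any constant will do. *)
  - exists 0; intros x Hx; destruct He; now exists x.
Qed.

Lemma antiderivatives_differ_by_const (a b : Rbar) (u F G : R -> C) :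
  antiderivative_on (open_itv a b) u F -> antiderivative_on (open_itv a b) u G ->
  exists c, forall x, open_itv a b x -> F x = G x + c.
Proof.
  intros HF HG.
  destruct (antiderivative_of_0 a b (fun x => F x - G x)) as [c Hc].
  - intros x Hx; eapply is_deriv_val.
    + exact (is_deriv_minus _ _ _ _ _ (HF x Hx) (HG x Hx)).
    + ring.
  - exists c; intros x Hx; rewrite <- (Hc x Hx); ring.
Qed.

(** By the fundamental theorem of calculus, the integral from a base point [x0] works: every segment
    from [x0] stays inside the interval, where [u] is continuous. *)
Lemma ex_antiderivative (a b : Rbar) (u : R -> C) :
  (forall x, open_itv a b x -> @continuous R_UniformSpace C_R_NormedModule u x) ->
  exists U, antiderivative_on (open_itv a b) u U.
Proof.
  intro Hu.
  destruct (classic (exists x0, open_itv a b x0)) as [[x0 H0] | He].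
  - exists (fun x => RInt (V := C_R_CompleteNormedModule) u x0 x).
    intros x Hx.
    apply (@is_derive_RInt C_R_NormedModule u _ x0); [|now apply Hu].
    apply (filter_imp (open_itv a b)); [|now apply locally_open_itv].
    intros t Ht; apply (@RInt_correct C_R_CompleteNormedModule).
    apply (@ex_RInt_continuous C_R_CompleteNormedModule).
    intros z Hz; now apply Hu, (open_itv_between _ _ x0 t).
  - exists (fun _ => 0); intros x Hx; destruct He; now exists x.
Qed.

(** * The factored equation with coefficients [p + q] and [p * q] *)

Section FactoredEquation.

Variables (a b : Rbar) (p q : C) (f IgR : R -> C).

Let g (x : R) := Cexp (p * x).
Let h (x : R) := Cexp (q * x).

Hypothesis hIgR : antiderivative_on (open_itv a b) (fun x => g x * f x) IgR.

Lemma factored_solution_form (K L y : R -> C) :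
  antiderivative_on (open_itv a b) (fun x => h x / g x * IgR x) K ->
  antiderivative_on (open_itv a b) (fun x => h x / g x) L ->
  is_solution (open_itv a b) (p + q) (p * q) f y ->
  exists C1 C2 : C, forall x : R, open_itv a b x ->
    y x = 1 / h x * K x + C1 / h x * L x + C2 / h x.
Proof.
  intros HK HL (y1 & y2 & Hy & Hy1 & Heq).
  destruct (antiderivatives_differ_by_const a b (fun x => g x * f x)
              (fun x => g x * (y1 x + q * y x)) IgR) as [C1 HC1]; [|exact hIgR|].
  (* Since [g' = p g], the derivative of [g (y' + q y)] is [g (y'' + (p + q) y' + p q y)], which is
     [g f]. *)
  { intros x Hx; eapply is_deriv_val.
    - apply is_deriv_mult; [apply is_deriv_Cexp_linear|].
      apply is_deriv_plus; [now apply Hy1|].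
      now apply is_deriv_scal, Hy.
    - fold (g x); rewrite <- (Heq x Hx); ring. }
  destruct (antiderivatives_differ_by_const a b
              (fun x => h x / g x * IgR x + C1 * (h x / g x))
              (fun x => h x * y x) (fun x => K x + C1 * L x)) as [C2 HC2].
  (* Here [(h y)' = h (y' + q y)], and [HC1] turns [y' + q y] into [(IgR + C1) / g]. *)
  { intros x Hx; eapply is_deriv_val.
    - apply is_deriv_mult; [apply is_deriv_Cexp_linear | now apply Hy].
    - fold (h x).
      replace (h x / g x * IgR x + C1 * (h x / g x))
        with (h x / g x * (IgR x + C1)) by ring.
      rewrite <- (HC1 x Hx); field; apply Cexp_neq_0. }
  { intros x Hx; apply is_deriv_plus; [now apply HK|].
    now apply is_deriv_scal, HL. }
  exists C1, C2; intros x Hx.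
  transitivity ((h x * y x) / h x).
  - field; apply Cexp_neq_0.
  - rewrite (HC2 x Hx); field; apply Cexp_neq_0.
Qed.

Lemma factored_form_solution (K L y : R -> C) (C1 C2 : C) :
  antiderivative_on (open_itv a b) (fun x => h x / g x * IgR x) K ->
  antiderivative_on (open_itv a b) (fun x => h x / g x) L ->
  (forall x : R, open_itv a b x ->
    y x = 1 / h x * K x + C1 / h x * L x + C2 / h x) ->
  is_solution (open_itv a b) (p + q) (p * q) f y.
Proof.
  intros HK HL Hy.
  assert (inv_exp : forall (c : C) (x : R), Cexp (- c * x) = / Cexp (c * x)).
  { intros c x; replace (- c * x) with (0 - c * x) by ring.
    rewrite Cexp_minus, Cexp_0; field; apply Cexp_neq_0. }
  (* [w] is the expected value of [y' + q y]. Writing [1 / g] as an exponential makes the product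
     rule sufficient. *)
  pose (w := fun x : R => Cexp (- p * x) * (IgR x + C1)).
  pose (y1 := fun x => w x - q * y x).
  assert (Dy : forall x, open_itv a b x -> is_deriv y x (y1 x)).
  { intros x Hx.
    apply (is_deriv_ext_itv a b (fun t => Cexp (- q * t) * (K t + C1 * L t + C2)));
      trivial.
    - intros t Ht; rewrite (Hy t Ht), inv_exp; fold (h t).
      field; apply Cexp_neq_0.
    - eapply is_deriv_val.
      + apply is_deriv_mult; [apply is_deriv_Cexp_linear|].
        apply is_deriv_plus; [|apply is_deriv_const].
        apply is_deriv_plus; [now apply HK|].
        now apply is_deriv_scal, HL.
      + unfold y1, w; rewrite (Hy x Hx), !inv_exp; fold (h x) (g x).
        field; split; apply Cexp_neq_0. }
  (* The second derivative is read off from the equation, which then holds trivially. It remains to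
     differentiate [y1 = w - q y], using [w' = f - p w]. *)
  exists y1, (fun x => f x - (p + q) * y1 x - p * q * y x).
  split; [exact Dy|split; [|intros; ring]].
  intros x Hx; eapply is_deriv_val.
  - apply is_deriv_minus; [|now apply is_deriv_scal, Dy].
    apply is_deriv_mult; [apply is_deriv_Cexp_linear|].
    apply is_deriv_plus; [now apply hIgR | apply is_deriv_const].
  - unfold y1, w; rewrite !inv_exp; fold (g x).
    field; apply Cexp_neq_0.
Qed.

End FactoredEquation.

Theorem corollary3 (a b : Rbar) (B C0 : C) (f : R -> C)
    (s : C) (hs : s ^ 2 = B ^ 2 - 4 * C0)
    (sgn : C) (hsgn : sgn = 1 \/ sgn = - (1))
    (IgR : R -> C)
    (hIgR : antiderivative_on (open_itv a b)
              (fun x => gfun B s sgn x * f x) IgR) :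
  (exists K : R -> C, antiderivative_on (open_itv a b)
     (fun x => hfun B s sgn x / gfun B s sgn x * IgR x) K) /\
  (exists L : R -> C, antiderivative_on (open_itv a b)
     (fun x => hfun B s sgn x / gfun B s sgn x) L) /\
  (forall K L : R -> C,
     antiderivative_on (open_itv a b)
       (fun x => hfun B s sgn x / gfun B s sgn x * IgR x) K ->
     antiderivative_on (open_itv a b)
       (fun x => hfun B s sgn x / gfun B s sgn x) L ->
     forall y : R -> C,
       is_solution (open_itv a b) B C0 f y <->
       exists C1 C2 : C, forall x : R, open_itv a b x ->
         y x = 1 / hfun B s sgn x * K x
               + C1 / hfun B s sgn x * L x
               + C2 / hfun B s sgn x).
Proof.
  set (p := B / 2 + sgn * (s / 2)).
  set (q := B / 2 - sgn * (s / 2)).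
  assert (two_neq_0 : RtoC 2 <> 0) by (intro H; apply RtoC_inj in H; lra).
  assert (sum_pq : B = p + q) by (unfold p, q; field; exact two_neq_0).
  assert (prod_pq : C0 = p * q).
  (* The sign enters [p * q] only through its square, so both choices give [(B^2 - s^2) / 4]. *)
  { assert (sgn2 : sgn * sgn = 1) by (destruct hsgn as [-> | ->]; ring).
    transitivity ((B ^ 2 - (sgn * sgn) * s ^ 2) / (2 * 2)).
    - rewrite sgn2, hs; replace (RtoC 4) with (RtoC 2 * RtoC 2)
        by (rewrite <- RtoC_mult; f_equal; lra).
      field; exact two_neq_0.
    - unfold p, q; field; exact two_neq_0. }
  (* The quotient is the single exponential of [(q - p) x]; its differentiability yields the
     continuity needed for both outer integrals. *)
  assert (ratio : forall x, is_deriv (fun t => hfun B s sgn t / gfun B s sgn t) x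
                              ((q - p) * Cexp ((q - p) * x))).
  { intro x; apply (is_derive_ext (V := C_R_NormedModule)
                      (fun t : R => Cexp ((q - p) * t))).
    - intro t; unfold hfun, gfun; fold p q; rewrite <- Cexp_minus.
      f_equal; ring.
    - apply is_deriv_Cexp_linear. }
  split; [|split].
  - apply ex_antiderivative; intros x Hx.
    (* [IgR] is continuous because it is differentiable, even where [f] is not continuous. *)
    eapply is_deriv_continuous, is_deriv_mult; [apply ratio | now apply hIgR].
  - apply ex_antiderivative; intros x Hx.
    eapply is_deriv_continuous, ratio.
  (* Only the coefficient of the equation is rewritten; the [B] inside [hfun] stays. *)
  - intros K L HK HL y; rewrite sum_pq at 1; rewrite prod_pq; split.
    + exact (factored_solution_form a b p q f IgR hIgR K L y HK HL).
    + intros (C1 & C2 & Hy).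
      exact (factored_form_solution a b p q f IgR hIgR K L y C1 C2 HK HL Hy).
Qed.
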